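(* Let $G$ and $H$ be finite simple graphs such that $G$ can be obtained from $H$ via a series of edge-contractions at edges not contained in triangles. If $H\in\mathcal{U}$, then $G\in\mathcal{U}$.
   Context: Let $V$ be a finite set of Boolean variables. A clause is a disjunction of literals from $V\cup\neg V\cup\{\top,\bot\}$; a CNF is a conjunction of clauses; it is reduced if unchanged under the rules $x\vee\top=\top$, $x\vee\bot=x$, $x\wedge\top=x$, $x\wedge\bot=\bot$, $x\vee x=x$, $x\wedge x=x$, $\neg\neg x=x$, $x\vee\neg x=\top$. A nontrivial reduced 2-CNF is a reduced CNF other than $\top,\bot$ all of whose clauses have exactly two literals. With $|x|=|\neg x|=x$, its associated multigraph has as vertices the variables occurring in it and one edge $\{|a|,|b|\}$ per clause $(a\vee b)$. The 2-CNF is simple if this multigraph has no multiple edges, and the graph is then denoted $\mathcal{G}(S)$. $\mathcal{U}$ is the family of graphs $\mathcal{G}(S)$ with $S$ an unsatisfiable simple 2-CNF. Edge-contraction at an edge $(u,v)$ merges $u$ and $v$ into a single new vertex $w$ (deleting the edge $(u,v)$), with all other edges incident to $u$ or $v$ becoming incident to $w$; each contraction in the series is performed at an edge of the current graph that lies in no triangle of that graph.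
   Formalization: The formal theorem also assumes that G has no isolated vertices; without this the claim fails, e.g. for H = K4 plus a disjoint edge, since contracting that edge leaves an isolated vertex and no graph in U has one. *)

(* Defs.v *)
From HB Require Import structures.
From mathcomp Require Import all_boot.
Set Implicit Arguments.
Unset Strict Implicit.
Unset Printing Implicit Defensive.

(* [Lit true v] is the variable v and [Lit false v] its negation; the rule
   [~~x = x] is thereby built into the representation. *)
Inductive literal (V : Type) := Top | Bot | Lit of bool & V.
Arguments Top {V}.
Arguments Bot {V}.

Section LiteralEq.
Variable V : finType.

Definition literal_code (l : literal V) : bool + bool * V :=
  match l with
  | Top => inl true
  | Bot => inl false
  | Lit b v => inr (b, v)
  end.

Definition literal_decode (s : bool + bool * V) : literal V :=
  match s with
  | inl true => Top
  | inl false => Bot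
  | inr (b, v) => Lit b v
  end.

Lemma literal_codeK : cancel literal_code literal_decode.
Proof. by case. Qed.

HB.instance Definition _ := Equality.copy (literal V) (can_type literal_codeK).

End LiteralEq.

(* A clause lists its disjuncts and a CNF its conjuncts; the order is
   irrelevant, so the rules below are stated up to [perm_eq]. *)
Definition clause (V : Type) := seq (literal V).
Definition cnf (V : Type) := seq (clause V).

Section CNF.
Variable V : finType.
Implicit Types (c r : clause V) (S R : cnf V).

Inductive clause_step c : clause V -> Prop :=
| OrTop x r of perm_eq c [:: x, Top & r] : clause_step c (Top :: r)
| OrBot x r of perm_eq c [:: x, Bot & r] : clause_step c (x :: r)
| OrIdem x r of perm_eq c [:: x, x & r] : clause_step c (x :: r)
| OrCompl b v r of perm_eq c [:: Lit b v, Lit (~~ b) v & r] :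
    clause_step c (Top :: r).

Inductive cnf_step S : cnf V -> Prop :=
| AndTop c R of perm_eq S [:: c, [:: Top] & R] : cnf_step S (c :: R)
| AndBot c R of perm_eq S [:: c, [:: Bot] & R] : cnf_step S ([:: Bot] :: R)
| AndIdem c c' R of perm_eq S [:: c, c' & R] & perm_eq c c' :
    cnf_step S (c :: R)
| InClause c c' R of perm_eq S (c :: R) & clause_step c c' :
    cnf_step S (c' :: R).

(* Every step lowers the number of clauses or the length of a clause, so
   being unchanged under the rules means that no step applies. *)
Definition reduced S : Prop := forall T, ~ cnf_step S T.

(* The empty conjunction is another way to write [Top]. *)
Definition nontrivial_reduced_2cnf S : Prop :=
  [/\ reduced S,
      [/\ S <> [::], S <> [:: [:: Top]] & S <> [:: [:: Bot]]]
    & forall c, c \in S -> size c = 2].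

Definition eval_literal (a : V -> bool) (l : literal V) : bool :=
  match l with
  | Top => true
  | Bot => false
  | Lit b v => if b then a v else ~~ a v
  end.

Definition eval_cnf (a : V -> bool) S : bool := all (has (eval_literal a)) S.

Definition unsatisfiable S : Prop := ~ exists a : V -> bool, eval_cnf a S.

Definition literal_over (v : V) (l : literal V) : bool :=
  if l is Lit _ w then w == v else false.

Definition occurs S (v : V) : bool := has (has (literal_over v)) S.

(* For a clause [:: a; b] of two literals from V and their negations this is
   the edge {|a|, |b|}. *)
Definition clause_edge c : {set V} := [set v | has (literal_over v) c].

(* The edges of the associated multigraph, listed with multiplicity. *)
Definition cnf_edges S : seq {set V} := [seq clause_edge c | c <- S].

Definition simple_2cnf S : Prop :=
  nontrivial_reduced_2cnf S /\ uniq (cnf_edges S).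

End CNF.

Record sgraph := SGraph {
  vertex :> finType;
  adj : rel vertex;
  adj_sym : symmetric adj;
  adj_irrefl : irreflexive adj }.

Definition graph_iso (G H : sgraph) : Prop :=
  exists2 f : G -> H, bijective f & forall x y, adj (f x) (f y) = adj x y.

Section GraphOfCNF.
Variables (V : finType) (S : cnf V).

(* The condition [x != y] only matters for non-reduced S: the two literals of
   a clause of a reduced 2-CNF lie over distinct variables. *)
Definition cnf_adj : rel {v : V | occurs S v} :=
  fun x y => (x != y) && ([set val x; val y] \in cnf_edges S).

Lemma cnf_adj_sym : symmetric cnf_adj.
Proof. by move=> x y; rewrite /cnf_adj eq_sym setUC. Qed.

Lemma cnf_adj_irrefl : irreflexive cnf_adj.
Proof. by move=> x; rewrite /cnf_adj eqxx. Qed.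

Definition cnf_graph : sgraph := SGraph cnf_adj_sym cnf_adj_irrefl.

End GraphOfCNF.

(* Membership in the family U; graphs are identified up to isomorphism, i.e.
   up to the names of the variables. *)
Definition supports_unsat (G : sgraph) : Prop :=
  exists (V : finType) (S : cnf V),
    [/\ simple_2cnf S, unsatisfiable S & graph_iso G (cnf_graph S)].

Section Contraction.
Variables (G : sgraph) (u v : G).

(* [None] is the vertex replacing u and v. *)
Definition contract_adj : rel (option {x : G | (x != u) && (x != v)}) :=
  fun p q => match p, q with
  | None, None => false
  | None, Some y => adj u (val y) || adj v (val y)
  | Some x, None => adj u (val x) || adj v (val x)
  | Some x, Some y => adj (val x) (val y)
  end.

Lemma contract_adj_sym : symmetric contract_adj.
Proof. by case=> [x|] [y|] //=; apply: adj_sym. Qed.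

Lemma contract_adj_irrefl : irreflexive contract_adj.
Proof. by case=> [x|] //=; apply: adj_irrefl. Qed.

Definition contract : sgraph := SGraph contract_adj_sym contract_adj_irrefl.

Definition triangle_free_edge : Prop :=
  adj u v /\ forall x, ~~ (adj u x && adj v x).

End Contraction.

(* [contracts_to H G]: G is obtained from H by finitely many (possibly zero)
   contractions, each at an edge in no triangle of the current graph. *)
Inductive contracts_to (H : sgraph) : sgraph -> Prop :=
| ContractDone G of graph_iso G H : contracts_to H G
| ContractStep (K : sgraph) (u v : K) G of contracts_to H K & triangle_free_edge u v
    & graph_iso G (contract u v) : contracts_to H G.

(* Every vertex of the graph of a CNF lies on an edge, whereas contracting an
   edge that is a whole connected component leaves an isolated vertex. *)
Definition no_isolated (G : sgraph) : Prop := forall x : G, exists y, adj x y.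

(* Main.v *)
Require Import Defs.
From mathcomp Require Import all_boot.

Set Implicit Arguments.
Unset Strict Implicit.
Unset Printing Implicit Defensive.

(** An unsatisfiable simple 2-CNF with graph [G] amounts to a choice, for every
    edge [xy], of the signs with which [x] and [y] occur in the clause of that
    edge. To contract [uv], whose clause is [(a \/ b)], delete this clause and
    identify [a] with the negation of [b]: a satisfying assignment of the
    result would satisfy all the other clauses and, since exactly one of [a]
    and [b] is true, also the deleted one. As [uv] lies in no triangle, the
    identification creates no multiple edges. *)

(* [s x y] is the sign of [x] in the clause of the edge [xy]. *)
Definition unsat_signing (G : sgraph) (s : G -> G -> bool) : Prop :=
  forall a : G -> bool, exists x y,
    [/\ adj x y, a x != s x y & a y != s y x].

Lemma unsat_signing_iso (G H : sgraph) (s : H -> H -> bool) :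
  graph_iso G H -> unsat_signing s -> exists t : G -> G -> bool, unsat_signing t.
Proof.
case=> f [g fK gK] adjf sP; exists (fun x y => s (f x) (f y)) => a.
have [x [y [xy ax ay]]] := sP (a \o g).
by exists (g x), (g y); rewrite -adjf !gK.
Qed.

(** The new vertex [None] stands for the literal of [u] in the clause of [uv], hence for the
    negation of the literal of [v] there. *)
Lemma unsat_signing_contract (K : sgraph) (u v : K) (s : K -> K -> bool) :
    triangle_free_edge u v -> unsat_signing s ->
  exists t : contract u v -> contract u v -> bool, unsat_signing t.
Proof.
case=> uv tri sP.
(* A neighbour of [None] is adjacent to only one of [u] and [v], so testing [adj u] finds the
   original edge. The sign at [None] says whether the literal there agrees with that of [u], or
   disagrees with that of [v], in the deleted clause. *)
pose t (p q : contract u v) := match p, q with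
  | Some x, Some y => s (val x) (val y)
  | Some x, None => if adj u (val x) then s (val x) u else s (val x) v
  | None, Some x => if adj u (val x) then s u v == s u (val x)
                    else s v u != s v (val x)
  | None, None => false
  end.
exists t => a.
(* Pulling [a] back makes exactly one literal of the deleted clause true. The final [false] is never
   reached. *)
pose a' (x : K) := if x == u then a None == s u v
  else if x == v then a None != s v u
  else if insub x is Some x' then a (Some x') else false.
have vu : v != u by apply: contraTneq uv => ->; rewrite adj_irrefl.
have a'u : a' u = (a None == s u v) by rewrite /a' eqxx.
have a'v : a' v = (a None != s v u) by rewrite /a' (negbTE vu) eqxx.
have a'S (x : {x : K | (x != u) && (x != v)}) : a' (val x) = a (Some x).
  by rewrite /a' valK; case/andP: (valP x) => /negbTE-> /negbTE->.
have vertexP x : [\/ x = u, x = v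
    | exists x' : {x : K | (x != u) && (x != v)}, x = val x'].
  have [->|xu] := eqVneq x u; first by constructor 1.
  have [->|xv] := eqVneq x v; first by constructor 2.
  have xP : (x != u) && (x != v) by rewrite xu.
  by constructor 3; exists (Sub x xP); rewrite SubK.
have falsified_u (y : {x : K | (x != u) && (x != v)}) : adj u (val y) ->
    a' u != s u (val y) -> a' (val y) != s (val y) u ->
  exists p q, [/\ adj p q, a p != t p q & a q != t q p].
  move=> uy; rewrite a'u a'S => au ay.
  exists None, (Some y); rewrite /= uy; split=> //.
  by move: au; case: (a None) (s u v) (s u (val y)) => [] [] [].
have falsified_v (y : {x : K | (x != u) && (x != v)}) : adj v (val y) ->
    a' v != s v (val y) -> a' (val y) != s (val y) v ->
  exists p q, [/\ adj p q, a p != t p q & a q != t q p].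
  move=> vy; rewrite a'v a'S => av ay.
  have nuy : adj u (val y) = false by have := tri (val y); rewrite vy andbT => /negbTE.
  exists None, (Some y); rewrite /= nuy vy; split=> //.
  by move: av; case: (a None) (s v u) (s v (val y)) => [] [] [].
have satisfied_uv : a' u != s u v -> a' v != s v u -> False.
  by rewrite a'u a'v; case: (a None) (s u v) (s v u) => [] [] [].
(* The edge falsified by [a'] cannot be [uv], so it survives in the contraction, where [a] falsifies
   it. *)
have [x [y [xy ax ay]]] := sP a'.
move: xy ax ay; case: (vertexP x) => [->|->|[x' ->]];
  case: (vertexP y) => [->|->|[y' ->]]; rewrite ?adj_irrefl // => xy ax ay.
- by case: satisfied_uv.
- exact: falsified_u xy ax ay.
- by case: satisfied_uv.
- exact: falsified_v xy ax ay.
- by apply: falsified_u ay ax; rewrite adj_sym.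
- by apply: falsified_v ay ax; rewrite adj_sym.
- by exists (Some x'), (Some y'); rewrite -!a'S.
Qed.

Lemma unsat_signing_contracts (G H : sgraph) :
    contracts_to H G -> (exists s : H -> H -> bool, unsat_signing s) ->
  exists t : G -> G -> bool, unsat_signing t.
Proof.
move=> HG hH; elim: HG => {G} [G iso|K u v G _ [s sP] tri iso].
  by case: hH => s /(unsat_signing_iso iso).
by have [t] := unsat_signing_contract tri sP; apply: unsat_signing_iso.
Qed.

(** * Syntactic form of the clauses of a simple 2-CNF *)

Section TwoClauses.
Variable V : finType.
Implicit Types (c : clause V) (S : cnf V).

Lemma clause_irreducible2P c : size c = 2 ->
  (forall r, ~ clause_step c r) <->
  exists b v b' w, v != w /\ c = [:: Lit b v; Lit b' w].
Proof.
case: c => [|l [|m []]] // _; split=> [irr|[b [v [b' [w [vw [-> ->]]]]]] r].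
  have swap (x y : literal V) : perm_eq [:: x; y] [:: y; x] by rewrite (perm_catC [:: x] [:: y]).
  (* The rules expect the constant in second place; [swap] serves when it comes first. *)
  case: l m irr => [||b v] [||b' w] irr;
    try by [case: (irr _ (OrTop (perm_refl _))) | case: (irr _ (OrBot (perm_refl _)))
           | case: (irr _ (OrTop (swap _ _))) | case: (irr _ (OrBot (swap _ _)))].
  exists b, v, b', w; split=> //; apply/eqP=> vw; rewrite vw in irr.
  have [eb|] := eqVneq b' b.
    by rewrite eb in irr; case: (irr _ (OrIdem (perm_refl _))).
  by case: b b' irr => [] [] // irr _; case: (irr _ (OrCompl (perm_refl _))).
have litE x : x \in [:: Lit b v; Lit b' w] -> x = Lit b v \/ x = Lit b' w.
  by rewrite !inE => /orP[] /eqP->; [left|right].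
have luniq : uniq [:: Lit b v; Lit b' w].
  by rewrite /= inE andbT; apply: contra vw => /eqP[_ ->].
case=> [x s|x s|x s|d z s] p.
- by have /litE[] : Top \in [:: Lit b v; Lit b' w] by rewrite (perm_mem p) !inE eqxx orbT.
- by have /litE[] : Bot \in [:: Lit b v; Lit b' w] by rewrite (perm_mem p) !inE eqxx orbT.
- by rewrite (perm_uniq p) /= inE eqxx in luniq.
- have /litE h1 : Lit d z \in [:: Lit b v; Lit b' w] by rewrite (perm_mem p) !inE eqxx.
  have /litE h2 : Lit (~~ d) z \in [:: Lit b v; Lit b' w].
    by rewrite (perm_mem p) !inE eqxx orbT.
  case: h1 h2 => [[-> ->]|[-> ->]] [[]|[]].
  + by case: b {litE luniq p}.
  + by move=> _ e; rewrite e eqxx in vw.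
  + by move=> _ e; rewrite e eqxx in vw.
  + by case: b' {litE luniq p}.
Qed.

Lemma clause_edge2 (b b' : bool) (v w : V) :
  clause_edge [:: Lit b v; Lit b' w] = [set v; w].
Proof. by apply/setP=> x; rewrite !inE /= orbF ![_ == x]eq_sym. Qed.

Lemma simple_2cnf_clauseP S c : simple_2cnf S -> c \in S ->
  exists b v b' w, v != w /\ c = [:: Lit b v; Lit b' w].
Proof.
case=> [[red _ sz] _] cS; apply/clause_irreducible2P; first exact: sz.
by move=> r cr; apply: (red (r :: rem c S)); apply: InClause cr; apply: perm_to_rem.
Qed.

Lemma simple_2cnf_intro S :
    S <> [::] -> uniq (cnf_edges S) ->
    (forall c, c \in S -> exists b v b' w, v != w /\ c = [:: Lit b v; Lit b' w]) ->
  simple_2cnf S.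
Proof.
move=> S0 Suniq SP.
have sz c : c \in S -> size c = 2.
  by move=> /SP[b [v [b' [w [_ ->]]]]].
do 2?split=> //; last first.
  by split=> // e; rewrite e in sz; have := sz _ (mem_head _ _).
move=> T [c R p|c R p|c c' R p cc'|c c' R p cc'].
- by have := sz [:: Top]; rewrite (perm_mem p) !inE eqxx orbT => /(_ isT).
- by have := sz [:: Bot]; rewrite (perm_mem p) !inE eqxx orbT => /(_ isT).
(* Clauses equal up to order have the same edge, so a clause can repeat only if an edge does. *)
- have e : clause_edge c = clause_edge c'.
    by apply/setP=> x; rewrite !inE; apply: eq_has_r; apply: perm_mem.
  by move: Suniq; rewrite (perm_uniq (perm_map _ p)) /= e inE eqxx.
- have cS : c \in S by rewrite (perm_mem p) mem_head.
  by have [_ /(_ (SP c cS))] := clause_irreducible2P (sz c cS); move/(_ c').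
Qed.

End TwoClauses.

(** * From 2-CNFs to signings *)

Lemma unsat_signing_cnf_graph (V : finType) (S : cnf V) :
    simple_2cnf S -> unsatisfiable S ->
  exists s : cnf_graph S -> cnf_graph S -> bool, unsat_signing s.
Proof.
move=> simS unS; have [_ Suniq] := simS.
(* Simplicity leaves one clause per edge, and its two variables differ, so this reads off the sign
   of [x] in it. *)
pose s (x y : cnf_graph S) :=
  has (fun c => (clause_edge c == [set val x; val y]) && (Lit true (val x) \in c)) S.
exists s => a.
(* The default value is harmless: the variables of the falsified clause all occur in [S]. *)
pose a' v := if insub v is Some x then a x else false.
have [c cS cF] : exists2 c, c \in S & ~~ has (eval_literal a') c.
  by apply/allPn/negP=> sat; apply: unS; exists a'.
have [b [v [b' [w [vw cE]]]]] := simple_2cnf_clauseP simS cS.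
have edge_inj d : d \in S -> clause_edge d = clause_edge c -> d = c.
  move=> dS dc; rewrite -[d](nth_index [::] dS) -[c](nth_index [::] cS); congr nth.
  apply/eqP; rewrite -(nth_uniq set0 _ _ Suniq) ?size_map ?index_mem //.
  by rewrite !(nth_map [::]) ?index_mem // !nth_index ?dc.
have over_occurs z : has (literal_over z) c -> occurs S z by move=> h; apply/hasP; exists c.
have vS : occurs S v by apply: over_occurs; rewrite cE /= eqxx.
have wS : occurs S w by apply: over_occurs; rewrite cE /= eqxx orbT.
have signE (x y : cnf_graph S) : clause_edge c = [set val x; val y] ->
    s x y = (Lit true (val x) \in c).
  move=> ce; apply/hasP/idP => [[d dS]|xc]; last by exists c; rewrite // ce eqxx.
  by rewrite -ce => /andP[/eqP/(edge_inj d dS)->].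
have edgeE : clause_edge c = [set v; w] by rewrite cE clause_edge2.
have litE (d d' : bool) (y z : V) : (Lit d y == Lit d' z) = (d == d') && (y == z).
  by apply/eqP/andP=> [[-> ->]|[/eqP-> /eqP->]].
exists (exist _ v vS), (exist _ w wS).
rewrite !signE /= ?edgeE // 1?setUC // cE !inE !litE !eqxx (negbTE vw) [w == v]eq_sym (negbTE vw).
rewrite !andbT !andbF orbF /=.
have a'E z (zS : occurs S z) : a' z = a (exist _ z zS) by rewrite /a' insubT.
move: cF; rewrite cE /= orbF (a'E v vS) (a'E w wS) negb_or => /andP[av aw].
split.
- by rewrite /cnf_adj -val_eqE /= vw /= -edgeE map_f.
- by move: av; case: b {cE}; case: (a _).
- by move: aw; case: b' {cE}; case: (a _).
Qed.

(** * From signings to 2-CNFs *)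

Section CNFOfSigning.
Variables (G : sgraph) (s : G -> G -> bool).

(* Each unordered edge is listed once, with its endpoints in increasing rank. *)
Definition oriented_edges : seq (G * G) :=
  [seq p <- enum {: G * G} | adj p.1 p.2 && (enum_rank p.1 < enum_rank p.2)].

Definition signed_clause (p : G * G) : clause G :=
  [:: Lit (s p.1 p.2) p.1; Lit (s p.2 p.1) p.2].

Definition signed_cnf : cnf G := [seq signed_clause p | p <- oriented_edges].

Lemma mem_oriented_edges (x y : G) :
  ((x, y) \in oriented_edges) = adj x y && (enum_rank x < enum_rank y).
Proof. by rewrite mem_filter mem_enum andbT. Qed.

Lemma adj_oriented (x y : G) :
  adj x y -> (x, y) \in oriented_edges \/ (y, x) \in oriented_edges.
Proof.
move=> xy; rewrite !mem_oriented_edges [adj y x]adj_sym xy /=.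
case: ltngtP; [by left | by right | move=> /ord_inj/enum_rank_inj e].
by rewrite e adj_irrefl in xy.
Qed.

Lemma signed_cnf_edges : cnf_edges signed_cnf = [seq [set p.1; p.2] | p <- oriented_edges].
Proof. by rewrite /cnf_edges -map_comp; apply: eq_map => p; apply: clause_edge2. Qed.

Lemma mem_signed_cnf_edges (x y : G) : x != y ->
  ([set x; y] \in cnf_edges signed_cnf) = adj x y.
Proof.
move=> xy; rewrite signed_cnf_edges; apply/mapP/idP => [[[u v]]|/adj_oriented[] h].
- rewrite mem_oriented_edges /= => /andP[uv _] e.
  have : x \in [set u; v] by rewrite -e !inE eqxx.
  have : y \in [set u; v] by rewrite -e !inE eqxx orbT.
  by rewrite !inE => /orP[]/eqP ey /orP[]/eqP ex; move: xy uv;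
    rewrite ex ey ?eqxx // adj_sym.
- by exists (x, y).
- by exists (y, x); rewrite // setUC.
Qed.

Lemma uniq_signed_cnf_edges : uniq (cnf_edges signed_cnf).
Proof.
rewrite signed_cnf_edges map_inj_in_uniq; first exact/filter_uniq/enum_uniq.
move=> [x y] [u v]; rewrite !mem_oriented_edges /= => /andP[_ xy] /andP[_ uv] e.
have : x \in [set u; v] by rewrite -e !inE eqxx.
have : y \in [set u; v] by rewrite -e !inE eqxx orbT.
rewrite !inE => /orP[]/eqP ey /orP[]/eqP ex; move: xy; rewrite ex ey ?ltnn //.
(* Only the crossed case [x = v], [y = u] is left, and there the ranks would increase both ways. *)
by rewrite ltnNge (ltnW uv).
Qed.

Hypothesis sP : unsat_signing s.

Lemma signed_cnf_unsat : unsatisfiable signed_cnf.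
Proof.
case=> a /allP aP; have [x [y [xy ax ay]]] := sP a.
(* A literal is true exactly when the value matches its sign, so the edge [xy] yields a falsified
   clause in either orientation. *)
have evalE b z : eval_literal a (Lit b z) = (a z == b) by case: b => /=; case: (a z).
by case: (adj_oriented xy) => /(map_f signed_clause)/aP;
  rewrite /= -!/(eval_literal a (Lit _ _)) !evalE (negbTE ax) (negbTE ay).
Qed.

Lemma signed_cnf_simple : simple_2cnf signed_cnf.
Proof.
apply: simple_2cnf_intro; last 1 first.
- move=> c /mapP[[x y]]; rewrite mem_oriented_edges => /andP[xy _] ->.
  exists (s x y), x, (s y x), y; split=> //.
  by apply: contraTneq xy => ->; rewrite adj_irrefl.
(* The empty CNF is satisfied by any assignment. *)
- by move=> e; apply: signed_cnf_unsat; rewrite e; exists xpredT.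
- exact: uniq_signed_cnf_edges.
Qed.

(** A vertex occurs as a variable once it lies on an edge; without isolated vertices the graph of
    the CNF has all of [G] as its vertices. *)
Lemma signed_cnf_graph : no_isolated G -> graph_iso G (cnf_graph signed_cnf).
Proof.
move=> noiso.
have occ x : occurs signed_cnf x.
  have [y /adj_oriented h] := noiso x; apply/hasP.
  by case: h => /(map_f signed_clause) h;
    [exists (signed_clause (x, y)) | exists (signed_clause (y, x))];
    rewrite //= eqxx ?orbT.
exists (fun x => exist _ x (occ x)).
  by exists val => x //; apply: val_inj.
move=> x y; rewrite /= /cnf_adj -val_eqE /=.
have [->|xy] := eqVneq x y; first by rewrite adj_irrefl.
exact: mem_signed_cnf_edges.
Qed.

End CNFOfSigning.

Theorem theorem7 (G H : sgraph) (hGH : contracts_to H G)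
    (hG : no_isolated G) (hH : supports_unsat H) :
  supports_unsat G.
Proof.
have [s sP] : exists s : G -> G -> bool, unsat_signing s.
  apply: unsat_signing_contracts hGH _.
  have [V [S [simS unS iso]]] := hH.
  by have [s /(unsat_signing_iso iso)] := unsat_signing_cnf_graph simS unS.
exists G, (signed_cnf s); split.
- exact: signed_cnf_simple.
- exact: signed_cnf_unsat.
- exact: signed_cnf_graph.
Qed.
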